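(* Let $$\varphi(t)=\frac1t\Bigl(\frac1{e^t-1}-\frac1t+\frac12\Bigr),\qquad t>0.$$ Let $\Delta:(0,\infty)\to\mathbb R$ be continuous with $\Delta(t)<0$ for all $t>0$ and $|\Delta(t)|\le Ce^{-ct}$ for all $t>0$, for some constants $C$ and $c>0$. Put $$L=\int_0^\infty\varphi(t)\,\Delta(t)\,dt,\qquad c_n=\frac{B_{2n}}{(2n)!}\int_0^\infty t^{2n-2}\,\Delta(t)\,dt\quad(n\ge1).$$ Then all these integrals converge absolutely, and for every integer $M\ge0$ $$(-1)^{M+1}\Bigl[L-\sum_{n=1}^{M}c_n\Bigr]>0.$$ Consequently, $L$ lies strictly between any two consecutive partial sums $\sum_{n=1}^{M}c_n$ and $\sum_{n=1}^{M+1}c_n$ ($M\ge0$), and $\operatorname{sign}c_n=(-1)^n$ for every $n\ge1$.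
   Context: $B_k$ are the Bernoulli numbers, $\frac{z}{e^z-1}=\sum_{k\ge0}B_k\frac{z^k}{k!}$ (so $B_1=-\tfrac12$, $B_2=\tfrac16$, $B_4=-\tfrac1{30}$). The empty sum ($M=0$) equals $0$. *)

(* Defs.v *)
From HB Require Import structures.
From mathcomp Require Import all_boot all_order all_algebra.
From mathcomp Require Import all_classical all_reals all_analysis.
From mathcomp Require Import ring lra.

Set Implicit Arguments.
Unset Strict Implicit.
Unset Printing Implicit Defensive.

Import Order.TTheory GRing.Theory Num.Theory.
Import numFieldNormedType.Exports.

Local Open Scope classical_set_scope.
Local Open Scope ring_scope.

(* The generating function identity is required on a punctured neighbourhood of
   0 only: the library's [z / (expR z - 1)] is 0 at [z = 0], where the analytic
   function takes the value 1. This determines [B] uniquely. *)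
Definition bernoulli_numbers (R : realType) (B : nat -> R) : Prop :=
  \forall z \near 0^', pseries (fun k => B k / k`!%:R) z @ \oo --> z / (expR z - 1).

Definition phi (R : realType) (t : R) : R :=
  t^-1 * ((expR t - 1)^-1 - t^-1 + 2^-1).

Definition phi_integral (R : realType) (Delta : R -> R) : R :=
  \int[@lebesgue_measure R]_(t in `]0, +oo[) (phi t * Delta t).

(* Only used for [n >= 1], where the truncated subtraction [2 * n - 2] is exact. *)
Definition bernoulli_moment (R : realType) (B : nat -> R) (Delta : R -> R)
    (n : nat) : R :=
  B (2 * n)%N / (2 * n)`!%:R *
  \int[@lebesgue_measure R]_(t in `]0, +oo[) (t ^+ (2 * n - 2) * Delta t).

Lemma bernoulli_coef_exist (R : realType) : exists b : nat -> R,
  b 0%N = 1 /\ forall n,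
    b n.+1 = - \sum_(k < n.+1) b k / (n.+2 - k)`!%:R.
Proof.
pose F (s : seq R) := - \sum_(k < size s) s`_k / ((size s).+1 - k)`!%:R.
pose st := fix st n : seq R :=
  if n is m.+1 then rcons (st m) (F (st m)) else [:: 1].
have sz n : size (st n) = n.+1 by elim: n => //= n IH; rewrite size_rcons IH.
have stE n k : (k <= n)%N -> (st n)`_k = (st k)`_k.
  elim: n => [|n IH]; first by rewrite leqn0 => /eqP ->.
  rewrite leq_eqVlt => /predU1P[->//|kn].
  by rewrite /= nth_rcons sz kn IH.
exists (fun n => (st n)`_n); split => // n.
rewrite /= nth_rcons sz ltnn eqxx /F sz; congr (- _).
by apply: eq_bigr => k _; rewrite stE // -ltnS.
Qed.

Lemma exp2_le_factS j : (2 ^ j <= j.+1`!)%N.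
Proof.
by elim: j => // j IH; rewrite expnS factS leq_mul.
Qed.

Lemma sum_half_le1 (R : realType) n : \sum_(k < n) (2^-1 : R) ^+ k.+1 <= 1.
Proof.
suff -> : \sum_(k < n) (2^-1 : R) ^+ k.+1 = 1 - 2^-1 ^+ n.
  by rewrite gerBl exprn_ge0 // invr_ge0.
elim: n => [|n IH]; first by rewrite big_ord0 expr0 subrr.
by rewrite big_ord_recr /= IH exprS; field.
Qed.

(* Partial sums of [z / (e^z - 1)] and [(e^z - 1) / z] are multiplied as
   polynomials; the tail of the product is O(N^2 |z|^N), whence [|z| < 1/8]. *)
Lemma bernoulli_numbers_exist (R : realType) :
  exists B : nat -> R, bernoulli_numbers B.
Proof.
have [b [b0 bS]] := bernoulli_coef_exist R.
pose e (j : nat) : R := (j.+1`!%:R)^-1.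
have e_ge0 j : 0 <= e j by rewrite invr_ge0.
have e_le j : e j <= 2^-1 ^+ j.
  rewrite /e exprVn lef_pV2 ?posrE ?ltr0n ?fact_gt0 ?exprn_gt0//.
  by rewrite -natrX ler_nat exp2_le_factS.
have e_le1 j : e j <= 1.
  by apply: le_trans (e_le j) _; rewrite exprn_ile1 ?invr_ge0 // invf_le1 // ler1n.
have b_le1 n : `|b n| <= 1.
  elim/ltn_ind: n => -[|n] IH; first by rewrite b0 normr1.
  rewrite bS normrN (le_trans (ler_norm_sum _ _ _)) //.
  apply: le_trans (sum_half_le1 R n.+1).
  rewrite [leRHS](reindex_inj rev_ord_inj) /=.
  apply: ler_sum => k _; rewrite normrM -[leRHS]mul1r.
  have kn : (k <= n)%N by rewrite -ltnS.
  rewrite ler_pM // ?IH // subSS.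
  have -> : (n.+2 - k = (n - k).+2)%N by rewrite subSn ?subSn // (leq_trans kn).
  by rewrite (ger0_norm (e_ge0 _)) e_le.
pose P N : {poly R} := \poly_(k < N) b k.
pose E N : {poly R} := \poly_(k < N) e k.
have coefPE_le N i : `|(P N * E N)`_i| <= i.+1%:R.
  rewrite coefM (le_trans (ler_norm_sum _ _ _)) //.
  have -> : i.+1%:R = \sum_(k < i.+1) (1 : R) by rewrite sumr_const card_ord.
  apply: ler_sum => k _.
  rewrite normrM !coef_poly.
  apply: mulr_ile1; rewrite ?normr_ge0 //.
    by case: ifP => _; rewrite ?normr0.
  by case: ifP => _; rewrite ?normr0 // ger0_norm.
have coefPE N i : (i < N)%N -> (P N * E N)`_i = (i == 0%N)%:R.
  move=> iN; rewrite coefM.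
  under eq_bigr => k _.
    rewrite !coef_poly (leq_ltn_trans _ iN) ?(leq_ltn_trans (leq_subr k i) iN);
      last by rewrite -ltnS.
    over.
  case: i iN => [|i] iN; first by rewrite big_ord1 b0 /e /= mul1r invr1.
  rewrite big_ord_recr /= subnn bS /e invr1 mulr1.
  apply/eqP; rewrite subr_eq0; apply/eqP/eq_bigr => k _.
  by rewrite -subSn // leqW // -ltnS.
exists (fun k => k`!%:R * b k).
rewrite /bernoulli_numbers.
near=> z.
have z0 : z != 0 by near: z; exact: nbhs_dnbhs_neq.
have z8 : `|z| < 8^-1.
  by near: z; apply: dnbhs0_lt; rewrite invr_gt0.
have ez0 : expR z - 1 != 0.
  by rewrite subr_eq0 -(@expR0 R) (inj_eq (@expR_inj R)).
pose T N : R := \sum_(N <= i < N + N) (P N * E N)`_i * z ^+ i.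
have hPE N : (0 < N)%N -> (P N).[z] * (E N).[z] = 1 + T N.
  move=> N0; rewrite -hornerM (@horner_coef_wide _ (N + N)); last first.
    apply: leq_trans (size_polyMleq _ _) _.
    by rewrite (leq_trans (leq_pred _)) // leq_add // size_poly.
  rewrite -(big_mkord xpredT (fun i => (P N * E N)`_i * z ^+ i)).
  rewrite (@big_cat_nat _ _ _ N) //= ?leq_addr //; congr (_ + _).
  rewrite big_ltn // coefPE // mul1r expr0 big_nat_cond big1 ?addr0 // => i.
  by case/andP => /andP[i0 iN] _; rewrite coefPE // -(prednK i0) mul0r.
have T_le N : `|T N| <= geometric 2 (4 * `|z|) N.
  have z1 : `|z| <= 1 by rewrite (le_trans (ltW z8)) // invf_le1 // ler1n.
  apply: (@le_trans _ _ (\sum_(N <= i < N + N) (N + N)%:R * `|z| ^+ N)).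
    apply: le_trans (ler_norm_sum _ _ _) _.
    rewrite big_nat_cond [leRHS]big_nat_cond; apply: ler_sum => i.
    case/andP => /andP[Ni iNN] _; rewrite normrM normrX ler_pM //.
      by rewrite (le_trans (coefPE_le _ _)) // ler_nat.
    exact: ler_wiXn2l.
  rewrite sumr_const_nat addnK /= exprMn -[leLHS]mulr_natr (mulrAC (N + N)%:R) [leRHS]mulrA.
  rewrite ler_wpM2r ?exprn_ge0 //.
  rewrite -natrX -!natrM ler_nat addnn -mul2n -mulnA leq_mul2l /=.
  have -> : 4%N = (2 * 2)%N by [].
  by rewrite expnMn leq_mul // ltnW // ltn_expl.
have Tcvg : T @ \oo --> 0.
  apply/norm_cvg0P/(@squeeze_cvgr _ _ _ _ (fun=> 0) (geometric 2 (4 * `|z|))).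
  - by near=> N; rewrite normr_ge0 T_le.
  - exact: cvg_cst.
  - by apply: cvg_geometric; rewrite normrM normr_id normr_nat; lra.
have Ecvg : (fun N => (E N).[z]) @ \oo --> (expR z - 1) / z.
  have h : (fun N => series (exp_coeff z) N.+1) @ \oo --> expR z.
    by rewrite (cvg_shiftS (series (exp_coeff z)) (nbhs (expR z))); exact: is_cvg_series_exp_coeff.
  have h2 : (fun N => (series (exp_coeff z) N.+1 - 1) / z) @ \oo -->
      (expR z - 1) / z.
    by apply: cvgM; [apply: cvgB => //|]; exact: cvg_cst.
  apply: cvg_trans h2; apply: near_eq_cvg; near=> N.
  rewrite /= horner_poly /series /= big_nat_recl // /exp_coeff /= expr0 divr1.
  rewrite addrC addrA addNr add0r big_mkord mulr_suml.
  apply: eq_bigr => i _; rewrite /e exprS; field.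
  by rewrite z0 pnatr_eq0 -lt0n fact_gt0.
have Ez0 : (expR z - 1) / z != 0 by rewrite mulf_neq0 // invr_eq0.
have h3 : (fun N => (1 + T N) / (E N).[z]) @ \oo --> z / (expR z - 1).
  have -> : z / (expR z - 1) = (1 + 0) / ((expR z - 1) / z).
    by rewrite addr0 mul1r invf_div.
  by apply: cvgM; [apply: cvgD => //; exact: cvg_cst | exact: cvgV].
apply: cvg_trans h3; apply: near_eq_cvg; near=> N.
have N0 : (0 < N)%N by near: N; exists 1%N.
have EN0 : (E N).[z] != 0 by near: N; exact: (cvgr_neq0 _ Ecvg Ez0).
rewrite /= -hPE // mulfK // horner_poly /pseries /series /= big_mkord.
apply: eq_bigr => i _; congr (_ * _).
by rewrite mulrC mulKf // pnatr_eq0 -lt0n fact_gt0.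
Unshelve. all: by end_near.
Qed.

(* Main.v *)
(* Let p_0 = x and let p_(k+1) be the solution of p_(k+1)'' = p_k vanishing at 0
   and 1/2; this is B_(2k+1)(x + 1/2) / (2k+1)!. For fixed t, the remainder
     D_M(x) = t sinh(t x) / (2 sinh(t / 2)) - \sum_(k < M) t^(2k+1) p_k(x)
   vanishes at 0 and 1/2 for M >= 1 and satisfies D_(M+1)'' = t^2 D_M. Since a
   strictly convex function vanishing at both ends is negative in between and has
   positive slope at the right end, induction gives the sign (-1)^M to D_M on
   (0, 1/2) and to D_(M+1)'(1/2). The latter number is
   t^3 (phi t - \sum_(1 <= n <= M) p_n'(1/2) t^(2n-2)), so phi is enveloped by its
   formal expansion. This expansion is therefore asymptotic at 0+, and uniqueness
   of asymptotic expansions gives p_n'(1/2) = B_(2n) / (2n)!. Integrating against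
   the negative function Delta finishes the proof. *)

Require Import Defs.
From mathcomp Require Import all_boot all_order all_algebra.
From mathcomp Require Import all_classical all_reals all_analysis.
From mathcomp Require Import ring lra zify measurable_realfun.

Set Implicit Arguments.
Unset Strict Implicit.
Unset Printing Implicit Defensive.

Import Order.TTheory GRing.Theory Num.Theory.
Import numFieldNormedType.Exports.

Local Open Scope classical_set_scope.
Local Open Scope ring_scope.

(** * Convex functions vanishing at both ends of an interval *)

Lemma MVT_everywhere (R : realType) (f df : R -> R) (a b : R) :
  (forall x : R, is_derive x 1 f (df x)) -> a < b ->
  exists2 x, a < x < b & f b - f a = df x * (b - a).
Proof.
move=> fdf ab; have [|x xab ?] := @MVT R f df a b ab (fun x _ => fdf x).
  by apply: derivable_within_continuous => x _; have [] := fdf x.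
by exists x => //; move: xab; rewrite in_itv.
Qed.

(** The derivative is strictly increasing. A value [f x >= 0] inside would give mean value points
    [u < x < v] with [df u >= 0 >= df v], a contradiction. At the right end, [df b] exceeds the zero
    of [df] provided by Rolle. *)
Lemma convex_zero_ends (R : realType) (f df ddf : R -> R) (a b : R) :
  (forall x : R, is_derive x 1 f (df x)) -> (forall x : R, is_derive x 1 df (ddf x)) ->
  a < b -> f a = 0 -> f b = 0 -> (forall x, a < x < b -> 0 < ddf x) ->
  (forall x, a < x < b -> f x < 0) /\ 0 < df b.
Proof.
move=> fdf dfddf ab fa fb ddf_gt0.
have df_incr x y : a <= x -> x < y -> y <= b -> df x < df y.
  move=> ax xy yb; have [z /andP[xz zy] e] := MVT_everywhere dfddf xy.
  rewrite -subr_gt0 e mulr_gt0 ?subr_gt0// ddf_gt0//.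
  by rewrite (le_lt_trans ax xz) (lt_le_trans zy yb).
split=> [x /andP[ax xb]|].
  have [u /andP[au ux]] := MVT_everywhere fdf ax.
  have [v /andP[xv vb]] := MVT_everywhere fdf xb.
  rewrite fa fb subr0 sub0r => fxv fxu.
  have uv : df u < df v by rewrite df_incr ?ltW// (lt_trans ux xv).
  rewrite ltNge; apply/negP => fx0.
  have du : 0 <= df u by rewrite -(@pmulr_lge0 _ (x - a)) ?subr_gt0// -fxu.
  have dv : df v <= 0 by rewrite -(@pmulr_lle0 _ (b - x)) ?subr_gt0// -fxv oppr_le0.
  by move: (lt_le_trans uv dv); rewrite ltNge du.
have [u /andP[au ub]] := MVT_everywhere fdf ab.
rewrite fa fb subr0 => /esym/eqP.
rewrite mulf_eq0 subr_eq0 (gt_eqF ab) orbF => /eqP <-.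
by rewrite df_incr// ltW.
Qed.

(** * The polynomials p_k *)

Lemma poly_antiderivative (R : numFieldType) (p : {poly R}) :
  exists q : {poly R}, q^`() = p.
Proof.
exists (\poly_(i < (size p).+1) (p`_i.-1 / i%:R)); apply/polyP => i.
rewrite coef_deriv coef_poly ltnS; case: ltnP => isz.
  by rewrite -[LHS]mulr_natr mulfVK// pnatr_eq0.
by rewrite mul0rn nth_default.
Qed.

(** Integrate twice, then subtract the affine interpolant at 0 and [a], which leaves the second
    derivative unchanged. *)
Lemma poly_dirichlet (R : numFieldType) (p : {poly R}) (a : R) : a != 0 ->
  exists q : {poly R}, [/\ q^`()^`() = p, q.[0] = 0 & q.[a] = 0].
Proof.
move=> a0; have [q1 q1p] := poly_antiderivative p.
have [q qq1] := poly_antiderivative q1.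
exists (q - (q.[0])%:P - ((q.[a] - q.[0]) / a) *: 'X); split.
- rewrite !derivB !derivZ derivX -polyC1 !derivC scaler0.
  by rewrite qq1 q1p !subr0.
- by rewrite !(hornerD, hornerN, hornerZ, hornerC, hornerX) mulr0 subrr subr0.
- by rewrite !(hornerD, hornerN, hornerZ, hornerC, hornerX) divfK// subrr.
Qed.

Lemma exists_odd_bernoulli_poly (R : numFieldType) : exists p : nat -> {poly R},
  p 0%N = 'X /\ forall k,
    [/\ (p k.+1)^`()^`() = p k, (p k.+1).[0] = 0 & (p k.+1).[2^-1] = 0].
Proof.
have h0 : (2^-1 : R) != 0 by rewrite invr_eq0.
pose next p := sval (cid (poly_dirichlet p h0)).
exists (fun k => iter k next 'X); split=> // k.
exact: (svalP (cid (poly_dirichlet _ h0))).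
Qed.

Lemma is_derive_exp_scale (R : realType) (a x : R) :
  is_derive x 1 (fun y => expR (a * y)) (a * expR (a * x)).
Proof.
have h : is_derive x 1 ( *%R a) a.
  by have := is_deriveZ a (is_derive_id x (1 : R)); rewrite /GRing.scale /= mulr1.
have := @is_derive1_comp _ expR ( *%R a) x _ _ (is_derive_expR _) h.
by rewrite mulrC.
Qed.

(** * Alternating signs of the remainders of phi *)

Section phi_alternation.
Context {R : realType} (p : nat -> {poly R}).
Hypothesis p0 : p 0%N = 'X.
Hypothesis pS : forall k,
  [/\ (p k.+1)^`()^`() = p k, (p k.+1).[0] = 0 & (p k.+1).[2^-1] = 0].

(** [sinhR] and [coshR] are twice the usual functions of [t * x]. The doubling cancels in the
    quotients below, so their [/ 2] is the 2 in t sinh(t x) / (2 sinh(t / 2)). *)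
Let sinhR (t x : R) := expR (t * x) - expR (- t * x).
Let coshR (t x : R) := expR (t * x) + expR (- t * x).

Let sinh_rem (t : R) (M : nat) (x : R) :=
  t / sinhR t 2^-1 / 2 * sinhR t x -
  \sum_(k < M) t ^+ (2 * k).+1 * (p k).[x].
Let dsinh_rem (t : R) (M : nat) (x : R) :=
  t ^+ 2 / sinhR t 2^-1 / 2 * coshR t x -
  \sum_(k < M) t ^+ (2 * k).+1 * (p k)^`().[x].

Let sinhR_gt0 t x : 0 < t -> 0 < x -> 0 < sinhR t x.
Proof.
move=> t0 x0; rewrite subr_gt0 ltr_expR mulNr.
by rewrite (@lt_trans _ _ 0) ?oppr_lt0 ?mulr_gt0.
Qed.

Let is_derive_sinhR t (x : R) : is_derive x 1 (sinhR t) (t * coshR t x).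
Proof.
have := is_deriveB (is_derive_exp_scale t x) (is_derive_exp_scale (- t) x).
by rewrite mulNr opprK -mulrDr.
Qed.

Let is_derive_coshR t (x : R) : is_derive x 1 (coshR t) (t * sinhR t x).
Proof.
have := is_deriveD (is_derive_exp_scale t x) (is_derive_exp_scale (- t) x).
by rewrite mulNr -mulrBr.
Qed.

Let is_derive_poly_sum (a : nat -> R) (q : nat -> {poly R}) M (x : R) :
  is_derive x 1 (fun x => \sum_(k < M) a k * (q k).[x])
    (\sum_(k < M) a k * (q k)^`().[x]).
Proof.
have e (r : nat -> {poly R}) y :
    \sum_(k < M) a k * (r k).[y] = (\sum_(k < M) a k *: r k).[y].
  by rewrite horner_sum; apply: eq_bigr => k _; rewrite hornerZ.
rewrite (e (fun k => (q k)^`())) (_ : (fun _ => _) = horner (\sum_(k < M) a k *: q k)); last first.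
  by apply/funext => y; rewrite e.
have -> : \sum_(k < M) a k *: (q k)^`() = (\sum_(k < M) a k *: q k)^`().
  by rewrite [RHS](raddf_sum (@deriv R)); apply: eq_bigr => k _; rewrite /= derivZ.
exact (is_derive_poly (\sum_(k < M) a k *: q k) x).
Qed.

Let is_derive_sinh_rem t M (x : R) :
  is_derive x 1 (sinh_rem t M) (dsinh_rem t M x).
Proof.
have := is_deriveB (is_deriveZ (t / sinhR t 2^-1 / 2) (is_derive_sinhR t x))
  (is_derive_poly_sum (fun k => t ^+ (2 * k).+1) p M x).
by rewrite /GRing.scale /= mulrA (_ : _ * t = t ^+ 2 / sinhR t 2^-1 / 2) //; ring.
Qed.

(** The linear term p_0 is lost in the second derivative, and p_(k+1)'' = p_k shifts the remaining
    sum down by one; this is why the index drops from [M.+1] to [M]. *)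
Let is_derive_dsinh_rem t M (x : R) :
  is_derive x 1 (dsinh_rem t M.+1) (t ^+ 2 * sinh_rem t M x).
Proof.
apply: is_derive_eq (is_deriveB
  (is_deriveZ (t ^+ 2 / sinhR t 2^-1 / 2) (is_derive_coshR t x))
  (is_derive_poly_sum (fun k => t ^+ (2 * k).+1) (fun k => (p k)^`()) M.+1 x)) _.
rewrite big_ord_recl p0 derivX derivC horner0 mulr0 add0r.
rewrite /sinh_rem /GRing.scale [RHS]mulrBr; congr (_ - _); first by rewrite /=; ring.
rewrite mulr_sumr; apply: eq_bigr => k _; have [-> _ _] := pS k.
by rewrite mulrA -exprD lift0 mulnS.
Qed.

Let sinh_rem_0 t M : sinh_rem t M 0 = 0.
Proof.
rewrite /sinh_rem /sinhR !mulr0 expR0 subrr mulr0 sub0r big1 ?oppr0//.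
move=> [[|k] _] _ /=; first by rewrite p0 hornerX mulr0.
by have [_ -> _] := pS k; rewrite mulr0.
Qed.

(** The hyperbolic term equals t / 2 at 1/2 and is cancelled by t p_0(1/2) alone. That term is
    present only from index 1 on, whence [M.+1]. *)
Let sinh_rem_half t M : 0 < t -> sinh_rem t M.+1 2^-1 = 0.
Proof.
move=> t0; rewrite /sinh_rem big_ord_recl p0 hornerX big1 => [|k _].
  have := sinhR_gt0 t0 (_ : 0 < 2^-1); rewrite invr_gt0 ltr0n => /(_ isT) s0.
  by field; rewrite gt_eqF.
by have [_ _] := pS k => /= ->; rewrite mulr0.
Qed.

Let sign_sinh_rem t M : 0 < t ->
  (forall x, 0 < x < 2^-1 -> 0 < (-1) ^+ M * sinh_rem t M x) /\
  0 < (-1) ^+ M * dsinh_rem t M.+1 2^-1.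
Proof.
move=> t0.
have h0 : (0 : R) < 2^-1 by rewrite invr_gt0.
(* The factor (-1)^N makes the second derivative of (-1)^N D_(N+1) positive, so a single use of
   [convex_zero_ends] yields both the next interior sign and the slope at 1/2. *)
have step N : (forall x, 0 < x < 2^-1 -> 0 < (-1) ^+ N * sinh_rem t N x) ->
    (forall x, 0 < x < 2^-1 -> 0 < (-1) ^+ N.+1 * sinh_rem t N.+1 x) /\
    0 < (-1) ^+ N * dsinh_rem t N.+1 2^-1.
  move=> IH; pose s : R := (-1) ^+ N.
  have [||||||neg ?] := @convex_zero_ends R (fun x => s * sinh_rem t N.+1 x)
    (fun x => s * dsinh_rem t N.+1 x) (fun x => s * (t ^+ 2 * sinh_rem t N x)) 0 2^-1.
  - by move=> x; exact: (is_deriveZ s (is_derive_sinh_rem t N.+1 x)).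
  - by move=> x; exact: (is_deriveZ s (is_derive_dsinh_rem t N x)).
  - by [].
  - by rewrite sinh_rem_0 mulr0.
  - by rewrite sinh_rem_half// mulr0.
  - by move=> x /IH; rewrite mulrCA; apply: mulr_gt0; rewrite exprn_gt0.
  split=> // x /neg.
  by rewrite exprS mulN1r mulNr oppr_gt0.
suff IH N x : 0 < x < 2^-1 -> 0 < (-1) ^+ N * sinh_rem t N x.
  by split; [exact: IH|have [] := step M (IH M)].
elim: N x => [|N IH] x; last by apply: (step N IH).1.
case/andP => x0 _; rewrite expr0 mul1r /sinh_rem big_ord0 subr0.
by rewrite !mulr_gt0 ?invr_gt0 ?sinhR_gt0.
Qed.

Lemma phi_alternation (t : R) (M : nat) : 0 < t ->
  0 < (-1) ^+ M *
    (phi t - \sum_(1 <= n < M.+1) (p n)^`().[2^-1] * t ^+ (2 * n - 2)).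
Proof.
move=> t0; have [_] := sign_sinh_rem M t0.
(* The hyperbolic term at 1/2 is (t^2 / 2) coth(t / 2) = t^2 (1 / (e^t - 1) + 1/2); subtracting t
   p_0'(1/2) = t leaves t^3 phi(t). *)
suff -> : dsinh_rem t M.+1 2^-1 = t ^+ 3 *
    (phi t - \sum_(1 <= n < M.+1) (p n)^`().[2^-1] * t ^+ (2 * n - 2)).
  by rewrite mulrCA pmulr_rgt0// exprn_gt0.
rewrite /dsinh_rem big_ord_recl p0 derivX hornerC big_add1 /= big_mkord mulrBr.
have -> : \sum_(k < M) t ^+ (2 * bump 0 k).+1 * (p (bump 0 k))^`().[2^-1] =
    t ^+ 3 * \sum_(k < M) (p k.+1)^`().[2^-1] * t ^+ (2 * k.+1 - 2).
  rewrite mulr_sumr; apply: eq_bigr => k _; rewrite /bump /= add1n.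
  rewrite mulrCA [RHS]mulrC -exprD; congr (t ^+ _ * _).
  by rewrite mulnS addnC addnK addnC.
rewrite opprD addrA; congr (_ - _).
rewrite /phi /sinhR /coshR mulNr expRN.
(* With u = e^(t/2) the identity becomes rational in t and u, and u > 1 keeps the denominators
   nonzero. *)
have -> : expR t = expR (t * 2^-1) ^+ 2.
  by rewrite expr2 -expRD -mulrDr (_ : 2^-1 + 2^-1 = 1 :> R) ?mulr1//; field.
have u1 : 1 < expR (t * 2^-1) by rewrite expR_gt1 mulr_gt0// invr_gt0.
move: (expR _) u1 => u u1.
have u0 : 0 < u by exact: lt_trans u1.
have uu : 0 < u ^+ 2 - 1 by rewrite subr_gt0 exprn_egt1.
rewrite muln0 expr1; field.
by rewrite !gt_eqF.
Qed.
End phi_alternation.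

(** * Identification of the coefficients with Bernoulli numbers *)

(** Letting t tend to 0+ kills the constant coefficient; dividing by X lowers both the size and the
    order of the bound, and induction applies. This is the uniqueness of asymptotic expansions. *)
Lemma poly_flat_at0 (R : realType) (p : {poly R}) (n : nat) (K r : R) :
  0 < r -> (size p <= n)%N ->
  (forall t, 0 < t < r -> `|p.[t]| <= K * t ^+ n) -> p = 0.
Proof.
move=> r0; elim: n p => [|n IH] p sp pK.
  by apply/eqP; rewrite -size_poly_leq0.
have p0 : p.[0] = 0.
  have cp : (fun t => `|p.[t]|) @ (0 : R)^'+ --> `|p.[0]|.
    by apply: cvg_norm; apply: cvg_at_right_filter; exact: continuous_horner.
  have cK : (fun t => K * t ^+ n.+1) @ (0 : R)^'+ --> K * 0 ^+ n.+1.
    apply: cvg_at_right_filter; apply: cvgM; first exact: cvg_cst.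
    exact: exprn_continuous.
  have : `|p.[0]| <= K * 0 ^+ n.+1.
    apply: (ler_cvg_to cp cK); near=> t; apply: pK; apply/andP; split.
      by near: t; exact: nbhs_right_gt.
    by near: t; exact: nbhs_right_lt.
  by rewrite expr0n /= mulr0 normr_le0 => /eqP.
have /factor_theorem[q] : root p 0 by apply/rootP.
rewrite subr0 => pq; rewrite pq; rewrite pq in sp pK.
have [->|q0] := eqVneq q 0; first by rewrite mul0r.
rewrite (IH q) ?mul0r// => [|t /[dup] /andP[t0 _] /pK].
  by rewrite size_mulX in sp.
by rewrite hornerM hornerX normrM (gtr0_norm t0) exprSr mulrA ler_pM2r.
Unshelve. all: by end_near.
Qed.

(* The terms of a series converging at [z] are bounded there, so at [t <= z / 2]
   its tail is dominated by a geometric one. *)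
Lemma pseries_remainder (R : realType) (a : nat -> R) (z : R) (N : nat) : 0 < z ->
  cvgn (pseries a z) -> exists K, forall t l, 0 < t < z / 2 ->
  pseries a t @ \oo --> l -> `|l - \sum_(k < N) a k * t ^+ k| <= K * t ^+ N.
Proof.
move=> z0 cz.
have [K0 K0P] : exists K0, forall k, `|a k| * z ^+ k <= K0.
  have [A [_ AP]] := cvg_series_bounded cz.
  exists (A + 1) => k; have /= := AP (A + 1) _ k I.
  by rewrite normrM normrX (gtr0_norm z0); apply; rewrite ltrDl.
have K0_ge0 : 0 <= K0 by apply: le_trans (K0P 0%N); rewrite mulr_ge0.
(* The factor 2 trades the ratio bound 2^-k for 2^-(k+1), whose partial sums are at most 1 by
   [sum_half_le1]. *)
exists (2 * K0 / z ^+ N) => t l /andP[t0 tz] tl.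
have tz2 : t / z <= 2^-1 by rewrite ler_pdivrMr// mulrC ltW.
have tz_ge0 : 0 <= t / z by rewrite divr_ge0 ?ltW.
have term k : `|a (N + k)%N * t ^+ (N + k)| <= 2 * K0 / z ^+ N * t ^+ N * 2^-1 ^+ k.+1.
  rewrite normrM normrX (gtr0_norm t0).
  have -> : t ^+ (N + k) = z ^+ (N + k) * ((t / z) ^+ N * (t / z) ^+ k).
    by rewrite -exprD -exprMn mulrC divfK// gt_eqF.
  rewrite mulrA; apply: (@le_trans _ _ (K0 * ((t / z) ^+ N * 2^-1 ^+ k))).
    rewrite ler_pM ?mulr_ge0 ?exprn_ge0 ?(ltW z0)//.
    by rewrite ler_wpM2l ?exprn_ge0// lerXn2r ?nnegrE ?invr_ge0.
  rewrite expr_div_n exprS le_eqVlt; apply/orP; left; apply/eqP; field.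
  by rewrite expf_neq0// gt_eqF.
have cl : (fun n => `|pseries a t (N + n)%N - \sum_(k < N) a k * t ^+ k|) @ \oo -->
    `|l - \sum_(k < N) a k * t ^+ k|.
  apply: cvg_norm; apply: cvgB; last exact: cvg_cst.
  rewrite (_ : (fun n => _) = (fun n => pseries a t (n + N)%N)); last first.
    by apply/funext => n; rewrite addnC.
  by rewrite (cvg_shiftn N (pseries a t) (nbhs l)).
rewrite -(cvg_lim _ cl)//; apply: limr_le; first by apply/cvg_ex; eexists; exact: cl.
near=> n; rewrite /pseries /series /= big_mkord big_split_ord /= addrAC subrr add0r.
apply: le_trans (ler_norm_sum _ _ _) _.
apply: (@le_trans _ _ (\sum_(k < n) 2 * K0 / z ^+ N * t ^+ N * 2^-1 ^+ k.+1)).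
  by apply: ler_sum => k _; exact: term.
rewrite -mulr_sumr ler_piMr ?sum_half_le1//.
by rewrite !mulr_ge0 ?invr_ge0 ?exprn_ge0 ?(ltW t0) ?(ltW z0).
Unshelve. all: by end_near.
Qed.

(** Since t / (e^t - 1) = 1 - t / 2 + t^2 phi(t), the truncated Bernoulli series [P] and the
    polynomial [Q] built from [beta] both approximate it up to O(t^(2n+2)). Their sizes are at most
    2n+2, so they coincide. *)
Lemma bernoulli_coefE (R : realType) (B beta : nat -> R) :
  bernoulli_numbers B ->
  (forall t M, 0 < t -> 0 < (-1) ^+ M *
    (phi t - \sum_(1 <= n < M.+1) beta n * t ^+ (2 * n - 2))) ->
  forall n, (1 <= n)%N -> B (2 * n)%N / (2 * n)`!%:R = beta n.
Proof.
move=> hB alt n n1.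
move: hB; rewrite /bernoulli_numbers near_withinE => /nbhs_ballP[r /= r0 hr].
have hB t : 0 < t < r ->
    pseries (fun k => B k / k`!%:R) t @ \oo --> t / (expR t - 1).
  case/andP => t0 tr; apply: hr; last by rewrite gt_eqF.
  by rewrite /ball /= sub0r normrN gtr0_norm.
have z0 : 0 < r / 2 by rewrite divr_gt0.
have cz : cvgn (pseries (fun k => B k / k`!%:R) (r / 2)).
  by apply/cvg_ex; eexists; apply: hB; rewrite z0 /= ltr_pdivrMr// ltr_pMr// ltr1n.
have [K KP] := pseries_remainder (2 * n).+2 z0 cz.
pose P := \poly_(k < (2 * n).+2) (B k / k`!%:R).
pose Q := 1 - 2^-1 *: 'X + \sum_(1 <= m < n.+1) beta m *: 'X^(2 * m) : {poly R}.
suff /polyP/(_ (2 * n)%N) : P - Q = 0.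
  have n20 : (2 * n == 0)%N = false by lia.
  have n21 : (2 * n == 1)%N = false by lia.
  rewrite coef0 coefB coef_poly ltnS leqnSn coefD coefB coef1 coefZ coefX.
  rewrite n20 n21 mulr0 subr0 add0r big_nat_recr//= coefD coefZ coefXn eqxx mulr1.
  rewrite coef_sum big_nat_cond big1 ?add0r => [/subr0_eq//|m].
  case/andP => /andP[_ mn] _; rewrite coefZ coefXn eqn_pmul2l//.
  by rewrite gtn_eqF// mulr0.
have szQ : (size Q <= (2 * n).+2)%N.
  rewrite (leq_trans (size_polyD _ _))// geq_max; apply/andP; split.
    rewrite (leq_trans (size_polyD _ _))// geq_max size_poly1 size_polyN /=.
    by rewrite (leq_trans (size_scale_leq _ _))// size_polyX.
  rewrite big_nat_cond (leq_trans (size_sum _ _ _))//.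
  apply/bigmax_leqP_seq => m _ /andP[/andP[_ mn] _].
  by rewrite (leq_trans (size_scale_leq _ _))// size_polyXn; lia.
(* The series is known to converge at r / 2, and [pseries_remainder] controls it up to half of that
   point. *)
apply: (@poly_flat_at0 R _ (2 * n).+2 (K + `|beta n.+1|) (r / 2 / 2)).
- by rewrite divr_gt0.
- by rewrite (leq_trans (size_polyD _ _))// geq_max size_polyN size_poly.
move=> t /[dup] tr /andP[t0 tr2].
have trr : 0 < t < r by rewrite t0 /=; lra.
have := KP t _ tr (hB t trr).
set l := t / _ => le1.
have le2 : `|l - Q.[t]| <= `|beta n.+1| * t ^+ (2 * n).+2.
  have -> : l - Q.[t] =
      t ^+ 2 * (phi t - \sum_(1 <= m < n.+1) beta m * t ^+ (2 * m - 2)).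
    rewrite /Q !hornerE horner_sum mulrBr /l /phi mulr_sumr.
    have -> : \sum_(1 <= m < n.+1) t ^+ 2 * (beta m * t ^+ (2 * m - 2)) =
        \sum_(1 <= m < n.+1) (beta m *: 'X^(2 * m)).[t].
      rewrite big_nat_cond [RHS]big_nat_cond; apply: eq_bigr => m.
      case/andP => /andP[m1 _] _; rewrite hornerZ hornerXn mulrCA -exprD.
      by congr (_ * t ^+ _); lia.
    move: (\sum_(1 <= m < n.+1) (_ *: _).[t]) => S.
    have et : 0 < expR t - 1 by rewrite subr_gt0 expR_gt1.
    by field; rewrite !gt_eqF.
  (* Enveloping: the remainders of order n and n+1 have opposite signs and differ by beta_(n+1)
     t^(2n), so this term bounds the first one in absolute value. *)
  have := alt t n t0; have := alt t n.+1 t0; rewrite big_nat_recr//=.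
  rewrite opprD addrA exprS mulN1r mulNr.
  set X := phi t - \sum_(1 <= m < n.+1) _.
  have -> : (2 * n.+1 - 2 = 2 * n)%N by lia.
  have -> : t ^+ (2 * n).+2 = t ^+ (2 * n) * t ^+ 2 by rewrite -exprD addn2.
  rewrite mulrA normrM [leLHS]mulrC (gtr0_norm (exprn_gt0 _ t0)).
  rewrite ler_pM2r ?exprn_gt0// => h1 h2.
  have b0 : `|beta n.+1| * t ^+ (2 * n) = `|beta n.+1 * t ^+ (2 * n)|.
    by rewrite normrM (gtr0_norm (exprn_gt0 _ t0)).
  rewrite b0; move: h1 h2; rewrite -signr_odd; case: (odd n).
    rewrite expr1 !mulN1r; rewrite opprK subr_gt0 oppr_gt0 => h1 h2.
    by rewrite ler0_norm ?(ltW h2)// ler_normr lerN2 (ltW h1) orbT.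
  rewrite expr0 !mul1r oppr_gt0 subr_lt0 => h1 h2.
  by rewrite gtr0_norm// ler_normr (ltW h1).
have PE : P.[t] = \sum_(k < (2 * n).+2) B k / k`!%:R * t ^+ k.
  by rewrite horner_poly.
rewrite hornerD hornerN mulrDl PE.
rewrite (_ : _ - _ = (l - Q.[t]) - (l - P.[t])) ?PE; last by ring.
by rewrite (le_trans (ler_normB _ _))// addrC lerD.
Qed.

(** * Integration against Delta *)

(** A zero integral would force [f] to vanish almost everywhere on [D]; as [f] vanishes nowhere
    there, [D] would be null. *)
Lemma Rintegral_gt0 d (T : measurableType d) (R : realType)
    (mu : {measure set T -> \bar R}) (D : set T) (f : T -> R) :
  measurable D -> mu D != 0%E -> mu.-integrable D (EFin \o f) ->
  (forall x, D x -> 0 < f x) -> 0 < \int[mu]_(x in D) f x.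
Proof.
move=> mD D0 intf f_gt0.
rewrite lt_def Rintegral_ge0 ?andbT => [|x /f_gt0/ltW//].
apply: contra D0 => /eqP If0.
have int0 : (\int[mu]_(x in D) `|(EFin \o f) x| = 0)%E.
  rewrite -[RHS]/(0%:E) -If0 /Rintegral fineK; last exact: integrable_fin_num.
  by apply: eq_integral => x /set_mem /f_gt0 fx; rewrite /= gtr0_norm.
have /(ae_eq_integral_abs mu mD) [/(_ int0) + _] := measurable_int mu intf.
move=> /negligibleS; move=> /(_ D) neg.
apply/eqP; apply: measure_negligible => //; apply: neg => x Dx /= /(_ Dx).
by case => fx0; have := f_gt0 _ Dx; rewrite fx0 ltxx.
Qed.

(** The dominating function is [K / a] times the exponential density of rate [a]. *)
Lemma integrable_exp_decay (R : realType) (f : R -> R) (K a : R) : 0 < a ->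
  measurable_fun (`]0, +oo[ : set R) f ->
  (forall t, 0 < t -> `|f t| <= K * expR (- a * t)) ->
  (@lebesgue_measure R).-integrable `]0, +oo[ (EFin \o f).
Proof.
move=> a0 mf fK.
have mD : measurable (`]0, +oo[ : set (measurableTypeR R)) by exact: measurable_itv.
have := integrableZl mD (K / a)
  (integrableS measurableT mD (@subsetT _ _) (integrable_exponential_pdf a0)).
apply: le_integrable => //; first exact/measurable_EFinP.
move=> t; rewrite /= in_itv /= andbT => t0.
rewrite lee_fin (exponential_pdfE _ (ltW t0)) mulrA divfK ?gt_eqF//.
exact: le_trans (fK t t0) (ler_norm _).
Qed.

(** Half of the decay rate absorbs the power, by x^n <= n! e^x at x = a t / 2. *)
Lemma powM_exp_decay (R : realType) (a t : R) (n : nat) : 0 < a -> 0 < t ->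
  t ^+ n * expR (- a * t) <= n`!%:R * (2 / a) ^+ n * expR (- (a / 2) * t).
Proof.
move=> a0 t0; have x0 : 0 <= a / 2 * t by rewrite !mulr_ge0 ?invr_ge0 ?ltW.
have h : (a / 2 * t) ^+ n <= n`!%:R * expR (a / 2 * t).
  case: n => [|n].
    by rewrite expr0 fact0 mul1r -[leLHS](@expR0 R) ler_expR.
  rewrite [leRHS]mulrC -ler_pdivrMr ?ltr0n ?fact_gt0//.
  by apply: le_trans (expR_ge1Dxn n x0); rewrite lerDr.
have -> : t ^+ n = (2 / a) ^+ n * (a / 2 * t) ^+ n.
  by rewrite -exprMn; congr (_ ^+ _); field; rewrite gt_eqF.
have -> : expR (- (a / 2) * t) = expR (a / 2 * t) * expR (- a * t).
  by rewrite -expRD; congr expR; field.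
set e := expR (- a * t); rewrite mulrAC [leRHS](_ : _ =
  (2 / a) ^+ n * e * (n`!%:R * expR (a / 2 * t))); last by ring.
by rewrite ler_wpM2l// mulr_ge0 ?expR_ge0// exprn_ge0// divr_ge0// ltW.
Qed.

Lemma measurable_phi (R : realType) : measurable_fun (`]0, +oo[ : set R) (@phi R).
Proof.
apply: open_continuous_measurable_fun; first exact: interval_open.
move=> t; rewrite inE /= in_itv /= andbT => t0.
have inv_cont (f : R -> R) : f t != 0 -> {for t, continuous f} ->
  {for t, continuous (fun x => (f x)^-1)} by exact: continuousV.
apply: continuousM; first by apply: inv_cont => //; rewrite gt_eqF.
apply: cvgD; last exact: cvg_cst.
apply: cvgB; last by apply: inv_cont => //; rewrite gt_eqF.
apply: inv_cont; first by rewrite gt_eqF// subr_gt0 expR_gt1.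
by apply: cvgB; [exact: continuous_expR | exact: cvg_cst].
Qed.

Theorem proposition4p3 (R : realType) (B : nat -> R) (Delta : R -> R) (C c : R)
    (hB : bernoulli_numbers B)
    (Delta_cont : {within `]0, +oo[, continuous Delta})
    (Delta_neg : forall t : R, 0 < t -> Delta t < 0)
    (c_gt0 : 0 < c)
    (Delta_decay : forall t : R, 0 < t -> `|Delta t| <= C * expR (- c * t)) :
  let mu := @lebesgue_measure R in
  let L := phi_integral Delta in
  let c_ := bernoulli_moment B Delta in
  let S := fun M : nat => \sum_(1 <= n < M.+1) c_ n in
  [/\ mu.-integrable `]0, +oo[ (fun t : R => (phi t * Delta t)%:E),
      forall n : nat, (1 <= n)%N ->
        mu.-integrable `]0, +oo[ (fun t : R => (t ^+ (2 * n - 2) * Delta t)%:E),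
      forall M : nat, 0 < (-1) ^+ M.+1 * (L - S M),
      forall M : nat, S M < L < S M.+1 \/ S M.+1 < L < S M &
      forall n : nat, (1 <= n)%N -> Num.sg (c_ n) = (-1) ^+ n].
Proof.
move=> mu L c_ S.
have [p [p0 pS]] := exists_odd_bernoulli_poly R.
pose beta n := (p n)^`().[2^-1].
have alt t M : 0 < t -> 0 < (-1) ^+ M *
    (phi t - \sum_(1 <= n < M.+1) beta n * t ^+ (2 * n - 2)).
  exact: phi_alternation p0 pS t M.
have betaE := bernoulli_coefE hB alt.
pose D : set (measurableTypeR R) := `]0, +oo[%classic.
have mD : measurable D by exact: measurable_itv.
have D_gt0 t : D t -> 0 < t by rewrite /D /= in_itv /= andbT.
have mDelta : measurable_fun (`]0, +oo[ : set R) Delta.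
  by apply: subspace_continuous_measurable_fun.
(* Nonnegativity of [C] follows from the decay bound at t = 1. *)
have C_ge0 : 0 <= C.
  have := le_trans (normr_ge0 _) (Delta_decay 1 ltr01).
  by rewrite pmulr_lge0// expR_gt0.
have int_mom k : mu.-integrable D (EFin \o (fun t => t ^+ k * Delta t)).
  apply: (@integrable_exp_decay R _ (C * (k`!%:R * (2 / c) ^+ k)) (c / 2)).
  - by rewrite divr_gt0.
  - by apply: measurable_funM => //; apply: measurable_funX; exact: measurable_id.
  move=> t t0; rewrite normrM normrX (gtr0_norm t0) -mulrA.
  apply: (@le_trans _ _ (C * (t ^+ k * expR (- c * t)))).
    by rewrite mulrCA ler_wpM2l ?exprn_ge0 ?(ltW t0)// Delta_decay.
  by rewrite ler_wpM2l// powM_exp_decay.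
(* The alternation at M = 0 and M = 1 reads 0 < phi(t) < beta_1. *)
have phi_bound t : 0 < t -> `|phi t| <= beta 1%N.
  move=> t0; have := alt t 0%N t0; have := alt t 1%N t0.
  rewrite big_nat1 big_geq// expr0 expr1 !mulN1r mul1r subr0 mulr1.
  by rewrite opprB subr_gt0 => /ltW h /gtr0_norm ->.
have int_phi : mu.-integrable D (EFin \o (fun t => phi t * Delta t)).
  apply: (@integrable_exp_decay R _ (beta 1%N * C) c) => //.
    by apply: measurable_funM => //; exact: measurable_phi.
  by move=> t t0; rewrite normrM -mulrA ler_pM// ?phi_bound ?Delta_decay.
pose rem M t := phi t - \sum_(1 <= n < M.+1) beta n * t ^+ (2 * n - 2).
(* Integrability of the remainder is carried through the induction because splitting the integral of
   a difference requires it. *)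
have remE M : mu.-integrable D (EFin \o (fun t => rem M t * Delta t)) /\
    L - S M = \int[mu]_(t in D) (rem M t * Delta t).
  elim: M => [|M [IHi IH]].
    have r0 t : rem 0%N t = phi t by rewrite /rem big_geq// subr0.
    rewrite /S big_geq// subr0; split; last by apply: eq_Rintegral => t _; rewrite r0.
    by apply: eq_integrable int_phi => // t _; rewrite /= r0.
  have rS t : rem M.+1 t * Delta t =
      rem M t * Delta t - beta M.+1 * (t ^+ (2 * M.+1 - 2) * Delta t).
    by rewrite /rem big_nat_recr//=; ring.
  have int_b : mu.-integrable D
      (EFin \o (fun t => beta M.+1 * (t ^+ (2 * M.+1 - 2) * Delta t))).
    exact: (integrableZl mD (beta M.+1) (int_mom (2 * M.+1 - 2)%N)).
  split.
    apply: eq_integrable (integrableB mD IHi int_b) => // t _.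
    by rewrite /= rS EFinB.
  under eq_Rintegral do rewrite rS.
  rewrite RintegralB// -IH RintegralZl//.
  by rewrite -betaE// /S big_nat_recr//= opprD addrA.
have pos M : 0 < (-1) ^+ M.+1 * (L - S M).
  have [int_r ->] := remE M; rewrite -RintegralZl//.
  apply: Rintegral_gt0 => //.
  - have := @lebesgue_measure_itv R `]0, +oo[; rewrite /= ltry => muD.
    by apply/eqP => D0; have := etrans (esym muD) D0.
  - exact: (integrableZl mD ((-1) ^+ M.+1) int_r).
  (* The negative sign of [Delta] turns the pointwise sign (-1)^M into (-1)^(M+1). *)
  move=> t /D_gt0 t0; rewrite mulrA exprS mulN1r mulNr nmulr_lgt0 ?Delta_neg//.
  by rewrite oppr_lt0; exact: alt.
have SS M : S M.+1 = S M + c_ M.+1 by rewrite /S big_nat_recr.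
split=> // [n _||[//|n] _].
- exact: int_mom.
- move=> M; have := pos M; have := pos M.+1.
  rewrite exprS mulN1r mulNr oppr_gt0 -signr_odd; case: odd.
    by rewrite expr1 !mulN1r oppr_lt0 oppr_gt0 subr_gt0 subr_lt0 => -> ->; right.
  by rewrite expr0 !mul1r subr_gt0 subr_lt0 => -> ->; left.
(* c_(n+1) is (L - S_n) - (L - S_(n+1)), a difference of numbers of opposite signs, so it has the
   sign (-1)^(n+1) of the first. *)
have := pos n; have := pos n.+1; rewrite SS exprS mulN1r mulNr oppr_gt0.
rewrite -[in RHS]signr_odd -signr_odd; case: odd.
  by rewrite expr1 !mulN1r => h1 h2; rewrite ltr0_sg//; lra.
by rewrite expr0 !mul1r => h1 h2; rewrite gtr0_sg//; lra.
Qed.
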